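(* Let $(X,\mathcal{A})$ be a measurable space, let $\mu\colon\mathcal{A}\to[0,\infty]$ be a nonadditive measure, and let $0<p<\infty$. Assume that $\mu$ is monotone autocontinuous from below and has property (C) and the pseudometric generating property (p.g.p.). Then $\mathcal{L}^{p,\infty}(\mu)$ and $L^{p,\infty}(\mu)$ are quasi-complete.
   Context: $X$ is a nonempty set and $\mathcal{A}$ is a $\sigma$-field of subsets of $X$. A nonadditive measure is a set function $\mu\colon\mathcal{A}\to[0,\infty]$ with $\mu(\emptyset)=0$ and $\mu(A)\le\mu(B)$ whenever $A,B\in\mathcal{A}$, $A\subset B$. $\mathcal{F}_0(X)$ is the real linear space of all $\mathcal{A}$-measurable functions $X\to\mathbb{R}$. Monotone autocontinuous from below: $\mu(A\setminus B_n)\to\mu(A)$ whenever $A,B_n\in\mathcal{A}$, $\{B_n\}_{n\in\mathbb{N}}$ is nonincreasing, and $\mu(B_n)\to 0$. (This implies null-additivity: $\mu(A\cup B)=\mu(A)$ whenever $\mu(B)=0$.) Property (C): for any sequence $\{E_n\}_{n\in\mathbb{N}}\subset\mathcal{A}$, if $\sup_{l\in\mathbb{N}}\mu\left(\bigcup_{n=k}^{k+l}E_n\right)\to 0$ as $k\to\infty$, then $\mu\left(\bigcup_{n=k}^\infty E_n\right)\to 0$ as $k\to\infty$. (p.g.p.): $\mu(A_n\cup B_n)\to 0$ whenever $A_n,B_n\in\mathcal{A}$ and $\max\{\mu(A_n),\mu(B_n)\}\to 0$. Shilkret integral: $\mathrm{Sh}(\nu,g):=\sup_{t\in[0,\infty)}t\,\nu(\{g>t\})\in[0,\infty]$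 for a nonadditive measure $\nu$ and measurable $g\colon X\to[0,\infty)$ (with $0\cdot\infty=0$). With $\mu^{1/p}(A):=\mu(A)^{1/p}$, define $\|f\|_{p,\infty}:=\mathrm{Sh}(\mu^{1/p},|f|)\in[0,\infty]$ for $f\in\mathcal{F}_0(X)$, and $\mathcal{L}^{p,\infty}(\mu):=\{f\in\mathcal{F}_0(X):\|f\|_{p,\infty}<\infty\}$ (in general not a linear space; $\|\cdot\|_{p,\infty}$ is nevertheless defined on all of $\mathcal{F}_0(X)$). $f\sim g$ iff $\mu(\{|f-g|>c\})=0$ for every $c>0$; this is an equivalence relation on $\mathcal{F}_0(X)$ here; $[f]$ is the class of $f$, with $[f]+[g]:=[f+g]$, $c[f]:=[cf]$. $L^{p,\infty}(\mu):=\{[f]: f\in\mathcal{L}^{p,\infty}(\mu)\}$ and $\|[f]\|_{p,\infty}:=\|f\|_{p,\infty}$ (well-defined since $\mu$ is null-additive). A sequence $\{x_n\}$ converges to $x$ if $\|x_n-x\|_{p,\infty}\to 0$; it is Cauchy if for any $\varepsilon>0$ there is $n_0$ with $\|x_m-x_n\|_{p,\infty}<\varepsilon$ for all $m,n\ge n_0$; it is bounded if $\sup_n\|x_n\|_{p,\infty}<\infty$. Quasi-complete means that every bounded Cauchy sequence in the space converges to an element of the space. *)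

(* Defs.v *)
From HB Require Import structures.
From mathcomp Require Import all_boot all_order all_algebra.
From mathcomp Require Import all_classical all_reals all_analysis.
From mathcomp Require Import measurable_realfun generic_quotient lra.

Set Implicit Arguments.
Unset Strict Implicit.
Unset Printing Implicit Defensive.

Import Order.TTheory GRing.Theory Num.Theory.
Import numFieldNormedType.Exports.

Local Open Scope classical_set_scope.
Local Open Scope ring_scope.
Local Open Scope ereal_scope.

(* The values of a nonadditive measure outside the sigma-field are irrelevant:
   below it is only ever evaluated at measurable sets. *)
Record nonadditive_measure d (T : measurableType d) (R : realType) :=
  NonadditiveMeasure {
  nam_fun :> set T -> \bar R ;
  nam0 : nam_fun set0 = 0 ;
  nam_ge0 : forall A, measurable A -> 0 <= nam_fun A ;
  nam_le : forall A B, measurable A -> measurable B -> A `<=` B ->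
    nam_fun A <= nam_fun B }.

Section Properties.
Context d (T : measurableType d) (R : realType).
Implicit Type mu : nonadditive_measure T R.

Definition monotone_autocontinuous_below mu :=
  forall (A : set T) (B : (set T)^nat),
    measurable A -> (forall n, measurable (B n)) -> nonincreasing_seq B ->
    mu (B n) @[n --> \oo] --> 0 ->
    mu (A `\` B n) @[n --> \oo] --> mu A.

Definition null_additive mu :=
  forall A B : set T, measurable A -> measurable B -> mu B = 0 ->
    mu (A `|` B) = mu A.

Definition property_C mu :=
  forall E : (set T)^nat, (forall n, measurable (E n)) ->
    ereal_sup (range (fun l : nat =>
      mu (\bigcup_(n in [set n | (k <= n <= k + l)%N]) E n)))
      @[k --> \oo] --> 0 ->
    mu (\bigcup_(n in [set n | (k <= n)%N]) E n) @[k --> \oo] --> 0.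

Definition pseudometric_generating mu :=
  forall A B : (set T)^nat,
    (forall n, measurable (A n)) -> (forall n, measurable (B n)) ->
    Order.max (mu (A n)) (mu (B n)) @[n --> \oo] --> 0 ->
    mu (A n `|` B n) @[n --> \oo] --> 0.

Lemma monotone_autocontinuous_below_null_additive mu :
  monotone_autocontinuous_below mu -> null_additive mu.
Proof.
move=> mac A B mA mB B0.
have mU : measurable (A `|` B) by exact: measurableU.
have cB : mu B @[_ --> \oo] --> (0 : \bar R) by rewrite B0; exact: cvg_cst.
have h := mac _ (fun=> B) mU (fun=> mB) (fun _ _ _ => lexx _) cB.
have E : mu ((A `|` B) `\` B) = mu (A `|` B).
  by apply: (cvg_unique (@ereal_hausdorff R) _ h); exact: cvg_cst.
apply/eqP; rewrite eq_le; apply/andP; split.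
  rewrite -E; apply: nam_le => //; first exact: measurableD.
  by move=> x [[]].
by apply: nam_le => //; exact: subsetUl.
Qed.

Lemma pseudometric_generating_null mu (A B : set T) :
  pseudometric_generating mu -> measurable A -> measurable B ->
  mu A = 0 -> mu B = 0 -> mu (A `|` B) = 0.
Proof.
move=> h mA mB A0 B0.
have h' := h (fun=> A) (fun=> B) (fun=> mA) (fun=> mB).
apply: (cvg_unique (@ereal_hausdorff R) _ (h' _)); first exact: cvg_cst.
by rewrite A0 B0 maxxx; exact: cvg_cst.
Qed.

End Properties.

Section Shilkret.
Context d (T : measurableType d) (R : realType).

Definition shilkret (nu : set T -> \bar R) (g : T -> R) : \bar R :=
  ereal_sup [set t%:E * nu [set x | (t < g x)%R] | t in [set t : R | (0 <= t)%R]].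

Definition weak_norm (mu : nonadditive_measure T R) (p : R) (f : T -> R) :=
  shilkret (fun A => mu A `^ p^-1) (fun x => `|f x|%R).

Definition weakL (mu : nonadditive_measure T R) (p : R) :
    set {mfun T >-> R} :=
  [set f : {mfun T >-> R} | weak_norm mu p f < +oo].

End Shilkret.

Section Quotient.
Context d (T : measurableType d) (R : realType).
Variable mu : nonadditive_measure T R.

Definition aeq (f g : {mfun T >-> R}) : bool :=
  `[< forall c : R, (0 < c)%R -> mu [set x | (c < `|f x - g x|)%R] = 0 >].

Lemma measurable_gt_norm (h : T -> R) (c : R) :
  measurable_fun setT h -> measurable [set x | (c < `|h x|)%R].
Proof.
move=> mh; rewrite -[X in measurable X]setTI.
have m : measurable_fun setT (fun x => `|h x|%R) by exact: measurableT_comp.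
have := m measurableT `]c, +oo[%classic (measurable_itv _).
by congr (measurable (_ `&` _)); apply/seteqP; split=> x /=; rewrite in_itv/= andbT.
Qed.

Lemma measurable_aeq (f g : {mfun T >-> R}) (c : R) :
  measurable [set x | (c < `|f x - g x|)%R].
Proof. by apply: measurable_gt_norm; exact: measurable_funB. Qed.

Lemma aeq_refl : reflexive aeq.
Proof.
move=> f; apply/asboolP => c c0; rewrite -(nam0 mu); congr (mu _).
apply/seteqP; split=> x //=.
by rewrite subrr normr0 => /(lt_trans c0); rewrite ltxx.
Qed.

Lemma aeq_sym : symmetric aeq.
Proof.
move=> f g; apply/asboolP/asboolP => h c c0; rewrite -(h c c0); congr (mu _);
  by apply/seteqP; split=> x /=; rewrite distrC.
Qed.

Lemma aeq_trans : pseudometric_generating mu -> transitive aeq.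
Proof.
move=> pgp g f h /asboolP fg /asboolP gh; apply/asboolP => c c0.
have c20 : (0 < c / 2)%R by lra.
have U0 := pseudometric_generating_null pgp (measurable_aeq f g (c / 2))
  (measurable_aeq g h (c / 2)) (fg _ c20) (gh _ c20).
apply/eqP; rewrite eq_le; apply/andP; split; last first.
  by apply: nam_ge0; exact: measurable_aeq.
rewrite -U0; apply: nam_le.
- exact: measurable_aeq.
- by apply: measurableU; exact: measurable_aeq.
- move=> x /= cx; have := ler_distD (g x) (f x) (h x).
  case: (ltP (c / 2)%R `|f x - g x|%R) => [?|h1]; first by left.
  case: (ltP (c / 2)%R `|g x - h x|%R) => [?|h2]; first by right.
  move: cx h1 h2; set a := `|_|%R; set b := `|_|%R; set e := `|_|%R; lra.
Qed.

Lemma aeqD (f f' g g' : {mfun T >-> R}) : pseudometric_generating mu ->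
  aeq f f' -> aeq g g' -> aeq (f + g)%R (f' + g')%R.
Proof.
move=> pgp ff gg; apply: (aeq_trans pgp (y := (f' + g)%R)).
- move/asboolP : ff => ff; apply/asboolP => c c0; rewrite -(ff c c0).
  congr (mu _); apply/seteqP; split=> x /=;
  by rewrite (_ : (f x + g x - (f' x + g x) = f x - f' x)%R)//; lra.
- move/asboolP : gg => gg; apply/asboolP => c c0; rewrite -(gg c c0).
  congr (mu _); apply/seteqP; split=> x /=;
  by rewrite (_ : (f' x + g x - (f' x + g' x) = g x - g' x)%R)//; lra.
Qed.

Lemma aeqZ (a : R) (f f' : {mfun T >-> R}) :
  aeq f f' -> aeq (a *: f)%R (a *: f')%R.
Proof.
move=> /asboolP ff; apply/asboolP => c c0.
have [->|a0] := eqVneq a 0%R.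
  rewrite -(nam0 mu); congr (mu _); apply/seteqP; split=> x //=.
  rewrite (_ : ((_ *: f) x - (_ *: f') x = 0 * f x - 0 * f' x)%R)//.
  by rewrite !mul0r subr0 normr0 => /(lt_trans c0); rewrite ltxx.
have na0 : (0 < `|a|)%R by rewrite normr_gt0.
have /ff <- : (0 < c / `|a|)%R by rewrite divr_gt0.
congr (mu _); apply/seteqP; split=> x /=;
  rewrite (_ : ((a *: f) x - (a *: f') x = a * f x - a * f' x)%R)//;
  by rewrite -mulrBr normrM ltr_pdivrMr// mulrC.
Qed.

Hypothesis pgp : pseudometric_generating mu.

Definition aeq_equiv : equiv_rel {mfun T >-> R} :=
  EquivRel aeq aeq_refl aeq_sym (aeq_trans pgp).

(* The quotient depends on [pgp], which is what makes [aeq] transitive. *)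
Definition F0q : Type := {eq_quot aeq_equiv}%qT.
HB.instance Definition _ := Choice.on F0q.
HB.instance Definition _ := EqQuotient.on F0q.

Local Open Scope quotient_scope.

Lemma F0qP (f g : {mfun T >-> R}) :
  \pi_F0q f = \pi_F0q g <->
  forall c : R, (0 < c)%R -> mu [set x | (c < `|f x - g x|)%R] = 0.
Proof. by split=> [/eqmodP/asboolP|h]//; apply/eqmodP/asboolP. Qed.

Definition F0q_zero : F0q := \pi_F0q (0%R : {mfun T >-> R}).
Definition F0q_add := lift_op2 F0q +%R.
Definition F0q_scale (a : R) := lift_op1 F0q ( *:%R a).
Definition F0q_opp (x : F0q) : F0q := F0q_scale (-1)%R x.

Lemma F0q_repr (f : {mfun T >-> R}) : aeq (repr (\pi_F0q f)) f.
Proof. by change (aeq_equiv (repr (\pi_F0q f)) f); apply/eqmodP; rewrite reprK. Qed.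

Lemma F0q_addE (f g : {mfun T >-> R}) :
  F0q_add (\pi_F0q f) (\pi_F0q g) = \pi_F0q (f + g)%R.
Proof. by unlock F0q_add; apply/eqmodP; apply: aeqD => //; exact: F0q_repr. Qed.

Lemma F0q_scaleE (a : R) (f : {mfun T >-> R}) :
  F0q_scale a (\pi_F0q f) = \pi_F0q (a *: f)%R.
Proof. by unlock F0q_scale; apply/eqmodP; apply: aeqZ; exact: F0q_repr. Qed.

Lemma F0q_addA : associative F0q_add.
Proof. by move=> x y z; rewrite -[x]reprK -[y]reprK -[z]reprK; rewrite !F0q_addE addrA. Qed.

Lemma F0q_addC : commutative F0q_add.
Proof. by move=> x y; rewrite -[x]reprK -[y]reprK; rewrite !F0q_addE addrC. Qed.

Lemma F0q_add0 : left_id F0q_zero F0q_add.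
Proof. by move=> x; rewrite -[x]reprK; rewrite F0q_addE add0r. Qed.

Lemma F0q_addN : left_inverse F0q_zero F0q_opp F0q_add.
Proof. by move=> x; rewrite -[x]reprK; rewrite /F0q_opp F0q_scaleE F0q_addE scaleN1r addNr. Qed.

HB.instance Definition _ :=
  GRing.isZmodule.Build F0q F0q_addA F0q_addC F0q_add0 F0q_addN.

Lemma F0q_scaleA (a b : R) (x : F0q) :
  F0q_scale a (F0q_scale b x) = F0q_scale (a * b)%R x.
Proof. by rewrite -[x]reprK; rewrite !F0q_scaleE scalerA. Qed.

Lemma F0q_scale1 : left_id 1%R F0q_scale.
Proof. by move=> x; rewrite -[x]reprK; rewrite F0q_scaleE scale1r. Qed.

Lemma F0q_scaleDr : right_distributive F0q_scale +%R.
Proof.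
move=> a; move=> x y; rewrite -[x]reprK -[y]reprK.
change (F0q_scale a (F0q_add (\pi_F0q (repr x)) (\pi_F0q (repr y))) =
  F0q_add (F0q_scale a (\pi_F0q (repr x))) (F0q_scale a (\pi_F0q (repr y)))).
by rewrite F0q_addE !F0q_scaleE scalerDr F0q_addE.
Qed.

Lemma F0q_scaleDl (x : F0q) : {morph F0q_scale^~ x : a b / (a + b)%R}.
Proof. by rewrite -[x]reprK => a b; rewrite !F0q_scaleE scalerDl -F0q_addE. Qed.

HB.instance Definition _ := GRing.Zmodule_isLmodule.Build R F0q
  F0q_scaleA F0q_scale1 F0q_scaleDr F0q_scaleDl.

Definition weakLq (p : R) : set F0q := [set \pi_F0q f | f in weakL mu p].

(* Independent of the representative when [mu] is null-additive: see
   [weak_normqE]. *)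
Definition weak_normq (p : R) (x : F0q) : \bar R := weak_norm mu p (repr x).

Lemma weak_norm_le_aeq (p : R) (f g : {mfun T >-> R}) : (0 < p)%R ->
  null_additive mu -> aeq f g -> weak_norm mu p f <= weak_norm mu p g.
Proof.
move=> p0 nulladd /asboolP fg; set G := weak_norm mu p g.
have ip0 : (0 <= p^-1)%R by rewrite invr_ge0 ltW.
have mgt (h : {mfun T >-> R}) (c : R) : measurable [set x | (c < `|h x|)%R].
  exact: measurable_gt_norm.
have H (s t : R) : (0 <= t < s)%R ->
    t%:E * mu [set x | (s < `|f x|)%R] `^ p^-1 <= G.
  move=> /andP[t0 ts].
  apply: (@le_trans _ _ (t%:E * mu [set x | (t < `|g x|)%R] `^ p^-1)).
    apply: lee_wpmul2l; first by rewrite lee_fin.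
    apply: gt0_ler_poweR => //; rewrite ?in_itv/= ?leey ?andbT ?nam_ge0//.
    have st0 : (0 < s - t)%R by lra.
    rewrite -(nulladd _ _ (mgt g t) (measurable_aeq f g (s - t)) (fg _ st0)).
    apply: nam_le => //; first by apply: measurableU => //; exact: measurable_aeq.
    move=> x /= sx; case: (ltP t `|g x|%R) => h1; [by left|right].
    have := ler_normD (f x - g x)%R (g x); rewrite subrK.
    by move: sx h1; set a := `|_|%R; set b := `|_|%R; set e := `|_|%R; lra.
  by apply: ereal_sup_ubound; exists t.
apply: ge_ereal_sup => _ [s /= s0 <-].
have [s_gt0|] := ltP 0%R s; last first.
  move=> s_le0; have -> : s = 0%R by lra.
  rewrite mul0e; apply: ereal_sup_ubound; exists 0%R => //=.
  by rewrite mul0e.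
move: (H s); have := poweR_ge0 (mu [set x | (s < `|f x|)%R]) p^-1.
case: (mu _ `^ _) => [r|_ Hs|//]; last first.
  have /Hs : (0 <= s / 2 < s)%R by apply/andP; split; lra.
  rewrite gt0_muley ?lte_fin; last by lra.
  by rewrite leye_eq => /eqP ->; rewrite leey.
rewrite lee_fin => r0 Hs.
have := Hs 0%R; rewrite mul0e s_gt0 lexx => /(_ isT).
case: G H Hs => [G _ Hs|_ _ _|_ _]; [|by rewrite leey|by []].
rewrite -!EFinM !lee_fin => G0; rewrite leNgt; apply/negP => Gs.
have r_gt0 : (0 < r)%R.
  by rewrite lt0r r0 andbT; apply/eqP => rz; move: Gs; rewrite rz; lra.
have /Hs : (0 <= (s + G / r) / 2 < s)%R.
  have : (G / r < s)%R by rewrite ltr_pdivrMr.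
  have : (0 <= G / r)%R by rewrite divr_ge0.
  by move=> ? ?; apply/andP; split; lra.
rewrite -EFinM lee_fin mulrAC mulrDl divfK ?gt_eqF//; lra.
Qed.

Lemma weak_normqE (p : R) (f : {mfun T >-> R}) : (0 < p)%R ->
  null_additive mu -> weak_normq p (\pi_F0q f) = weak_norm mu p f.
Proof.
move=> p0 na; apply/eqP; rewrite eq_le; apply/andP; split;
  apply: weak_norm_le_aeq => //; first exact: F0q_repr.
by rewrite aeq_sym; exact: F0q_repr.
Qed.

End Quotient.

Arguments weakLq {d T R mu} pgp p.
Arguments weak_normq {d T R mu} pgp p x.

Section QuasiComplete.
Context (R : realType) (V : zmodType) (N : V -> \bar R).

(* [N] need be neither finite nor subadditive, and membership in the
   space [S] does not pass to differences. *)
Definition N_bounded (u : nat -> V) :=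
  ereal_sup (range (fun n => N (u n))) < +oo.

Definition N_cauchy (u : nat -> V) :=
  forall e : R, (0 < e)%R -> exists n0 : nat,
    forall m n, (n0 <= m)%N -> (n0 <= n)%N -> N (u m - u n)%R < e%:E.

Definition N_cvg (u : nat -> V) (x : V) :=
  N (u n - x)%R @[n --> \oo] --> 0.

Definition quasi_complete (S : set V) :=
  forall u : nat -> V, (forall n, S (u n)) -> N_bounded u -> N_cauchy u ->
    exists2 x, S x & N_cvg u x.

End QuasiComplete.

(* Main.v *)
(** A Cauchy sequence in the weak norm is Cauchy in measure. The (p.g.p.) gives
    radii [r k] decreasing to 0 such that a union of two sets of measure at most
    [r k.+1] has measure at most [r k]. Along a fast subsequence the sets
    [E k = {2^-k < |f_(k+1) - f_k|}] have measure at most [r k.+1], hence all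
    finite tail unions of the [E n], [n >= k], have measure at most [r k], and
    property (C) makes the infinite tail unions [B k] vanish in measure. Off
    [B k] the subsequence converges uniformly to some [g].
    Monotone autocontinuity from below makes the weak norm lower semicontinuous
    under such convergence. Applied to the subsequence itself, this shows that
    [g] has finite weak norm; applied to [f n] minus the subsequence, it shows
    that [f n] tends to [g] in the weak norm. *)
Require Import Defs.
From mathcomp Require Import all_boot all_order all_algebra.
From mathcomp Require Import all_classical all_reals all_analysis.
From mathcomp Require Import measurable_realfun generic_quotient ring lra zify.

Set Implicit Arguments.
Unset Strict Implicit.
Unset Printing Implicit Defensive.

Import Order.TTheory GRing.Theory Num.Theory.
Import numFieldNormedType.Exports.

Local Open Scope classical_set_scope.
Local Open Scope ring_scope.

(** * Extended-real preliminaries *)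

Lemma cvge0P (R : realType) (X : (\bar R)^nat) : (forall n, 0 <= X n)%E ->
  X n @[n --> \oo] --> 0%E <->
  (forall e : R, 0 < e -> \forall n \near \oo, (X n < e%:E)%E).
Proof.
move=> X0; split.
  move/fine_cvgP => [Xfin /cvgr0Pnorm_lt XN] e e0.
  near=> n.
  have Xn : X n \is a fin_num by near: n.
  rewrite -(fineK Xn) lte_fin; apply: le_lt_trans (ler_norm _) _.
  by near: n; exact: XN.
move=> Xlt; apply/fine_cvgP; split.
  near=> n; rewrite ge0_fin_numE//; apply: (@lt_le_trans _ _ 1%:E); last exact: leey.
  by near: n; exact: Xlt.
apply/cvgr0Pnorm_lt => e e0; near=> n.
have Xn : (X n < e%:E)%E by near: n; exact: Xlt.
have Xfin : X n \is a fin_num by rewrite ge0_fin_numE// (lt_le_trans Xn)// leey.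
by rewrite /= ger0_norm ?fine_ge0// -lte_fin fineK.
Unshelve. all: by end_near. Qed.

(** Raising to the power [p] is monotone and inverts [p^-1]; at [x = +oo] both sides are false. *)
Lemma mule_poweR_leP (R : realType) (p t M : R) (x : \bar R) :
  0 < p -> 0 < t -> 0 <= M -> (0 <= x)%E ->
  (t%:E * x `^ p^-1 <= M%:E)%E <-> (x <= ((M / t) `^ p)%:E)%E.
Proof.
move=> p0 t0 M0; case: x => [x|_|]; last by rewrite leNgt ltNyr.
  2: by rewrite poweRyr ?invr_eq0 ?gt_eqF// gt0_muley ?lte_fin//; split;
    rewrite leNgt ltry.
rewrite poweR_EFin -EFinM !lee_fin => x0.
have Mt0 : 0 <= M / t by rewrite divr_ge0// ltW.
rewrite mulrC -ler_pdivlMr//; split => h.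
  rewrite -(powRr1 x0) -(mulVf (lt0r_neq0 p0)) powRrM.
  by apply: ge0_ler_powR => //; rewrite ?nnegrE ?powR_ge0// ltW.
rewrite -(powRr1 Mt0) -(divff (lt0r_neq0 p0)) powRrM.
by apply: ge0_ler_powR => //; rewrite ?nnegrE ?powR_ge0// invr_ge0 ltW.
Qed.

(** * Level-set bounds and semicontinuity of the weak norm *)

Section WeakNorm.
Context d (T : measurableType d) (R : realType).
Variables (mu : nonadditive_measure T R) (p : R).
Hypothesis p0 : 0 < p.

Lemma weak_norm_ge0 (f : T -> R) : (0 <= weak_norm mu p f)%E.
Proof. by apply: ereal_sup_ubound; exists 0 => //=; rewrite mul0e. Qed.

(** A Chebyshev-type bound that is also sufficient, since the level [t = 0] contributes 0 to the
    supremum. *)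
Lemma weak_norm_leP (f : T -> R) (M : R) : measurable_fun setT f -> 0 <= M ->
  (weak_norm mu p f <= M%:E)%E <->
  (forall t, 0 < t -> (mu [set x | (t < `|f x|)%R] <= ((M / t) `^ p)%:E)%E).
Proof.
move=> mf M0; have mg t : (0 <= mu [set x | (t < `|f x|)%R])%E.
  by apply: nam_ge0; exact: measurable_gt_norm.
split=> [fM t t0|fM].
  apply/mule_poweR_leP => //; apply: le_trans fM.
  by apply: ereal_sup_ubound; exists t => //=; exact: ltW.
apply: ge_ereal_sup => _ [t /= t0 <-].
have [->|tN0] := eqVneq t 0; first by rewrite mul0e lee_fin.
have {tN0}t0 : 0 < t by rewrite lt0r tN0.
by apply/mule_poweR_leP => //; exact: fM.
Qed.

(** For [s < t] and [e k < t - s], a point off [B k] with [|g| > t] has [|h k| > s]. So the level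
    set of [g] minus [B k] obeys the bound for [h k] at level [s], and autocontinuity removes [B k]
    in the limit. *)
Lemma weak_norm_lower_semicontinuous (g : T -> R) (h : (T -> R)^nat)
    (B : (set T)^nat) (e : R^nat) (M : R) :
  monotone_autocontinuous_below mu ->
  measurable_fun setT g -> (forall k, measurable_fun setT (h k)) ->
  (forall k, measurable (B k)) -> nonincreasing_seq B ->
  mu (B k) @[k --> \oo] --> 0%E -> e k @[k --> \oo] --> 0 ->
  (forall k x, ~ B k x -> `|h k x - g x| <= e k) ->
  0 < M -> (\forall k \near \oo, (weak_norm mu p (h k) <= M%:E)%E) ->
  (weak_norm mu p g <= M%:E)%E.
Proof.
move=> mac mg mh mB Bdec B0 e0 hg M0 hM.
apply/lee_addgt0Pr => r r0; rewrite -EFinD.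
have Mr0 : 0 < M + r by rewrite addr_gt0.
apply/weak_norm_leP => //; first exact: ltW.
(* The level [s] solves [M / s = (M + r) / t]: the slack [r] in the norm pays for lowering the
   level. *)
move=> t t0; set s := t * M / (M + r).
have s0 : 0 < s by rewrite !mulr_gt0// invr_gt0.
have st : s < t by rewrite /s ltr_pdivrMr// ltr_pM2l// ltrDl.
have -> : (M + r) / t = M / s.
  by rewrite /s; field; rewrite !gt_eqF.
have mA : measurable [set x | (t < `|g x|)%R] by exact: measurable_gt_norm.
apply: cvge_le (mac _ B mA mB Bdec B0).
near=> k.
have ek : `|e k| < t - s.
  by near: k; move/cvgr0Pnorm_lt : e0; apply; rewrite subr_gt0.
have hk : (weak_norm mu p (h k) <= M%:E)%E by near: k.
apply: le_trans ((weak_norm_leP (mh k) (ltW M0)).1 hk s s0).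
apply: nam_le.
- exact: measurableD.
- exact: measurable_gt_norm.
- move=> x [/= tx /hg hx]; have := ler_distD (h k x) (g x) 0.
  rewrite !subr0 distrC.
  have := ler_norm (e k); lra.
Unshelve. all: by end_near. Qed.

Lemma N_cauchy_in_measure (f : nat -> {mfun T >-> R}) :
  N_cauchy (fun f : {mfun T >-> R} => weak_norm mu p f) f ->
  forall c e : R, 0 < c -> 0 < e -> exists n0 : nat,
    forall m n, (n0 <= m)%N -> (n0 <= n)%N ->
      (mu [set x | (c < `|f m x - f n x|)%R] <= e%:E)%E.
Proof.
move=> fC c e c0 e0.
have M0 : 0 < c * e `^ p^-1 by rewrite mulr_gt0// powR_gt0.
have [n0 fn0] := fC _ M0; exists n0 => m n mn0 nn0.
have mfmn : measurable_fun setT (f m - f n) by exact: measurable_funPT.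
have := (weak_norm_leP mfmn (ltW M0)).1 (ltW (fn0 _ _ mn0 nn0)) c c0.
by rewrite mulrAC divff ?gt_eqF// mul1r -powRrM mulVf ?gt_eqF// powRr1 // ltW.
Qed.

End WeakNorm.

(** * Real sequences with eventually geometric increments *)

Section GeometricCauchy.
Context (R : realType).
Variables (y : R^nat) (k : nat).
Hypothesis yk : forall j, (k <= j)%N -> `|y j.+1 - y j| <= 2^-1 ^+ j.

(** The right side is the exact geometric sum of the increments; keeping the subtracted term lets
    the induction close. *)
Lemma geometric_dist i j : (k <= i)%N ->
  `|y (i + j)%N - y i| <= 2 * 2^-1 ^+ i - 2 * 2^-1 ^+ (i + j).
Proof.
move=> ki; elim: j => [|j IH]; first by rewrite addn0 !subrr normr0.
have := ler_distD (y (i + j)%N) (y (i + j).+1%N) (y i).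
have := yk (leq_trans ki (leq_addr j i)).
by rewrite addnS exprS; lra.
Qed.

Lemma geometric_dist_le i j : (k <= i)%N ->
  `|y (i + j)%N - y i| <= 2 * 2^-1 ^+ i.
Proof.
move=> ki; have := geometric_dist j ki.
have : 0 <= 2^-1 ^+ (i + j) :> R by rewrite exprn_ge0// invr_ge0.
lra.
Qed.

Lemma cvg_geometric2 : (2 * 2^-1 ^+ i : R) @[i --> \oo] --> 0.
Proof.
have -> : (fun i => 2 * 2^-1 ^+ i : R) = geometric 2 2^-1 by [].
by apply: cvg_geometric; rewrite ger0_norm ?invr_ge0// invf_lt1// ltr1n.
Qed.

Lemma geometric_cauchy_cvg : cvgn y.
Proof.
apply/cauchy_cvgP/cauchy_exP => e e0.
have [N _ HN] : \forall i \near \oo, 2 * 2^-1 ^+ i < e.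
  move/cvgr0Pnorm_lt : cvg_geometric2 => /(_ _ e0); apply: filterS => i.
  exact: le_lt_trans (ler_norm _).
exists (y (N + k)%N), (N + k)%N => // j /= /subnKC <-.
rewrite -ball_normE /= distrC; apply: le_lt_trans (HN (N + k)%N _).
  by rewrite geometric_dist_le// leq_addl.
by rewrite /= leq_addr.
Qed.

Lemma geometric_dist_lim i : (k <= i)%N -> `|y i - limn y| <= 2 * 2^-1 ^+ i.
Proof.
move=> ki; have yl : `|y i - y n| @[n --> \oo] --> `|y i - limn y|.
  by apply: cvg_norm; apply: cvgB; [exact: cvg_cst | exact: geometric_cauchy_cvg].
apply: cvgr_to_le yl _; exists i => // n /= /subnKC <-.
by rewrite distrC geometric_dist_le.
Qed.

End GeometricCauchy.

(** * From Cauchy in measure to uniform convergence off small sets *)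

Section ConvergenceInMeasure.
Context d (T : measurableType d) (R : realType).
Variable mu : nonadditive_measure T R.
Hypotheses (mu_C : property_C mu) (mu_pgp : pseudometric_generating mu).

(** If every radius [1 / (n + 1)] failed, the witnessing pairs of sets would contradict the
    (p.g.p.). *)
Lemma pseudometric_generating_le (e : R) : 0 < e -> exists2 r : R, 0 < r &
  forall A B, measurable A -> measurable B ->
    (mu A <= r%:E)%E -> (mu B <= r%:E)%E -> (mu (A `|` B) <= e%:E)%E.
Proof.
move=> e0; apply: contrapT => noR.
have /choice[AB ABP] : forall n : nat, exists AB : set T * set T,
    [/\ measurable AB.1, measurable AB.2, (mu AB.1 <= (n.+1%:R^-1)%:E)%E,
        (mu AB.2 <= (n.+1%:R^-1)%:E)%E & (e%:E < mu (AB.1 `|` AB.2))%E].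
  move=> n; apply: contrapT => noAB; apply: noR; exists n.+1%:R^-1 => //.
  move=> A B mA mB An Bn; rewrite leNgt; apply/negP => eAB.
  by apply: noAB; exists (A, B).
have mA n : measurable (AB n).1 by have [] := ABP n.
have mB n : measurable (AB n).2 by have [] := ABP n.
have /cvge0P : mu ((AB n).1 `|` (AB n).2) @[n --> \oo] --> 0%E.
  apply: mu_pgp => //; apply/cvge0P.
    by move=> n; rewrite le_max nam_ge0.
  move=> r r0; have := near_infty_natSinv_lt (PosNum r0); apply: filterS => n nr.
  have [_ _ An Bn _] := ABP n.
  by rewrite (@le_lt_trans _ _ (n.+1%:R^-1)%:E) ?lte_fin// ge_max An.
move=> /(_ (fun n => nam_ge0 mu (measurableU _ _ (mA n) (mB n))) _ e0)[N _ HN].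
have [_ _ _ _] := ABP N; rewrite ltNge => /negP; apply.
by apply/ltW/HN => /=.
Qed.

Lemma pseudometric_generating_seq : exists r : R^nat,
  (forall k, 0 < r k /\ r k.+1 <= r k) /\ r k @[k --> \oo] --> 0 /\
  forall k A B, measurable A -> measurable B ->
    (mu A <= (r k.+1)%:E)%E -> (mu B <= (r k.+1)%:E)%E ->
    (mu (A `|` B) <= (r k)%:E)%E.
Proof.
have /choice[F FP] : forall e : R, exists r, 0 < e -> [/\ 0 < r, r <= 2^-1 * e &
    forall A B, measurable A -> measurable B ->
    (mu A <= r%:E)%E -> (mu B <= r%:E)%E -> (mu (A `|` B) <= e%:E)%E].
  (* The value 0 is a placeholder making [F] total; the iterates from 1 stay positive. Below, the
     cap at [e / 2] forces them to decrease to 0. *)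
  move=> e; have [e0|e0] := ltP 0 e; last by exists 0.
  have [r r0 Hr] := pseudometric_generating_le e0.
  exists (Num.min r (2^-1 * e)) => _; split.
  - by rewrite lt_min r0 mulr_gt0.
  - by rewrite ge_min lexx orbT.
  - move=> A B mA mB hA hB; apply: Hr => //; [apply: le_trans hA _ |
      apply: le_trans hB _]; by rewrite lee_fin ge_min lexx.
pose r k := iter k F 1.
have r0 k : 0 < r k by elim: k => [|k /FP[]].
exists r; split; [|split].
- move=> k; split=> //; have [_ + _] := FP _ (r0 k).
  by have := r0 k; rewrite /r /=; lra.
- apply: (@squeeze_cvgr _ _ _ _ (fun=> 0) (fun k => 2^-1 ^+ k)).
  + apply: nearW => k; rewrite ltW//=; elim: k => [|k IH]; first by rewrite expr0.
    have [_ h _] := FP _ (r0 k); apply: le_trans h _.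
    by rewrite exprS ler_pM2l.
  + exact: cvg_cst.
  + by apply: cvg_expr; rewrite ger0_norm ?invr_ge0// invf_lt1// ltr1n.
- by move=> k; have [_ _] := FP _ (r0 k).
Unshelve. all: by end_near. Qed.

Lemma cauchy_in_measure_subsequence (f : (T -> R)^nat) :
  (forall n, measurable_fun setT (f n)) ->
  (forall c e : R, 0 < c -> 0 < e -> exists n0 : nat,
    forall m n, (n0 <= m)%N -> (n0 <= n)%N ->
      (mu [set x | (c < `|f m x - f n x|)%R] <= e%:E)%E) ->
  exists (phi : nat -> nat) (B : (set T)^nat) (g : T -> R),
    (forall k, (k <= phi k)%N) /\ (forall k, measurable (B k)) /\
    nonincreasing_seq B /\ mu (B k) @[k --> \oo] --> 0%E /\
    measurable_fun setT g /\
    (forall k x, ~ B k x -> `|f (phi k) x - g x| <= 2 * 2^-1 ^+ k).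
Proof.
move=> mf fC; have [r [r0 [r_cvg rU]]] := pseudometric_generating_seq.
have half0 k : 0 < 2^-1 ^+ k :> R by rewrite exprn_gt0.
have /choice[N HN] := fun k => fC _ _ (half0 k) (r0 k.+1).1.
(* The sum puts both [phi k] and [phi k.+1] above [N k]; the summand [k] makes [phi] unbounded. *)
pose phi k := (k + \sum_(i < k.+1) N i)%N.
have phiN k : (N k <= phi k)%N.
  by rewrite /phi big_ord_recr /= addnA leq_addl.
have phiNS k : (N k <= phi k.+1)%N.
  by rewrite /phi !big_ord_recr /=; lia.
pose E k := [set x | (2^-1 ^+ k < `|f (phi k.+1) x - f (phi k) x|)%R].
have mE k : measurable (E k).
  by apply: measurable_gt_norm; exact: measurable_funB.
have muE k : (mu (E k) <= (r k.+1)%:E)%E by exact: HN.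
pose B k := \bigcup_(n in [set n | (k <= n)%N]) E n.
pose U k l := \bigcup_(n in [set n | (k <= n <= k + l)%N]) E n.
have mB k : measurable (B k) by exact: bigcup_measurable.
have mU k l : measurable (U k l) by exact: bigcup_measurable.
(* Induction on the length for all starting points at once: [E k] and [U k.+1 l] are both of measure
   at most [r k.+1], so [rU] bounds their union by [r k]. *)
have muU l : forall k, (mu (U k l) <= (r k)%:E)%E.
  elim: l => [|l IH] k.
    have -> : U k 0%N = E k.
      apply/seteqP; split => [x [n /=]|x Ex]; last by exists k => //=; lia.
      by move=> kn; have -> : n = k by lia.
    by apply: le_trans (muE k) _; rewrite lee_fin (r0 k).2.
  have -> : U k l.+1 = E k `|` U k.+1 l; last exact: rU.
  apply/seteqP; split => [x [n /= kn Ex]|x [Ex|[n /= kn Ex]]].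
  - by have [<-|nk] := eqVneq n k; [left|right; exists n => //=; lia].
  - by exists k => //=; lia.
  - by exists n => //=; lia.
have B0 : mu (B k) @[k --> \oo] --> 0%E.
  apply: mu_C => //; apply/cvge0P.
    move=> k; apply: (@le_trans _ _ (mu (U k 0%N))); first exact: nam_ge0.
    by apply: ereal_sup_ubound; exists 0%N.
  move=> e e0; move/cvgr0Pnorm_lt : r_cvg => /(_ _ e0); apply: filterS => k rk.
  apply: (@le_lt_trans _ _ (r k)%:E).
    by apply: ge_ereal_sup => _ [l _ <-]; exact: muU.
  by rewrite lte_fin; apply: le_lt_trans rk; exact: ler_norm.
have BE k x : ~ B k x -> forall j, (k <= j)%N ->
    `|f (phi j.+1) x - f (phi j) x| <= 2^-1 ^+ j.
  move=> NB j kj; rewrite leNgt; apply/negP => h; apply: NB; by exists j.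
(* Multiplying by the indicator of [C] makes the subsequence converge everywhere, with limit 0 off
   [C], so [g] is a measurable pointwise limit. *)
pose C := \bigcup_k ~` B k.
have mC : measurable C.
  by apply: bigcup_measurable => k _; exact: measurableC.
pose g x := limn (fun j => f (phi j) x * \1_C x).
exists phi, B, g; split; [|split=> //; split; [|split=> //; split]].
- by move=> k; exact: leq_addr.
- move=> i j ij; apply/subsetPset => x [n /= jn Ex]; exists n => //=.
  exact: leq_trans jn.
- apply: (@measurable_fun_cvg _ _ _ _ (fun j x => f (phi j) x * \1_C x)).
    by move=> j; apply: measurable_funM => //; exact: measurable_indic.
  move=> x _; suff : cvgn (fun j => f (phi j) x * \1_C x) by [].
  under eq_fun do rewrite indicE.
  have [|xC] := boolP (x \in C); last first.
    by under eq_fun do rewrite mulr0; exact: is_cvg_cst.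
  rewrite inE => -[k _ kx]; under eq_fun do rewrite mulr1.
  exact: geometric_cauchy_cvg (BE k x kx).
- move=> k x kx; have := geometric_dist_lim (BE k x kx) (leqnn k).
  have xC : \1_C x = 1 :> R by rewrite indicE mem_set//; exists k.
  by congr (`|_ - limn _| <= _); apply/funext => j; rewrite xC mulr1.
Qed.
End ConvergenceInMeasure.

(** * Quasi-completeness for functions, then for classes *)

Lemma quasi_complete_weakL d (T : measurableType d) (R : realType)
    (mu : nonadditive_measure T R) (p : R) :
  0 < p -> monotone_autocontinuous_below mu -> property_C mu ->
  pseudometric_generating mu ->
  quasi_complete (fun f : {mfun T >-> R} => weak_norm mu p f) (weakL mu p).
Proof.
move=> p0 mac muC pgp f fL fbd fC.
have mf n : measurable_fun setT (f n) by exact: measurable_funPT.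
have [phi [B [g [phik [mB [Bdec [B0 [mg fg]]]]]]]] :=
  cauchy_in_measure_subsequence muC pgp mf (N_cauchy_in_measure p0 fC).
pose G : {mfun T >-> R} := mfun_Sub (mem_set mg).
exists G.
- pose M := ereal_sup (range (fun n => weak_norm mu p (f n))).
  have fM n : (weak_norm mu p (f n) <= M)%E by apply: ereal_sup_ubound; exists n.
  have M0 : (0 <= M)%E := le_trans (weak_norm_ge0 mu p _) (fM 0%N).
  have Mfin : M \is a fin_num by rewrite ge0_fin_numE.
  (* Adding 1 makes the bound positive, as semicontinuity requires, even when [M] is 0. *)
  apply: (@le_lt_trans _ _ (fine M + 1)%:E); last exact: ltry.
  change (weak_norm mu p g <= (fine M + 1)%:E)%E.
  apply: (weak_norm_lower_semicontinuous p0 (h := fun k => f (phi k)) mac mg _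
    mB Bdec B0 (@cvg_geometric2 R) fg) => //.
    by rewrite ltr_wpDl// fine_ge0.
  apply: nearW => k; apply: le_trans (fM _) _.
  by rewrite EFinD fineK// leeDl// lee_fin.
- apply/cvge0P => [n|e e0]; first exact: weak_norm_ge0.
  have e20 : 0 < e / 2 by rewrite divr_gt0.
  have [n0 fn0] := fC _ e20; exists n0 => // n /= nn0.
  apply: (@le_lt_trans _ _ (e / 2)%:E); last by rewrite lte_fin; lra.
  (* For fixed [n], subtracting from [f n] keeps the sets [B k] and the rates; [phi k >= k] brings
     the Cauchy bound into force. *)
  apply: (weak_norm_lower_semicontinuous p0 (g := (f n - G : {mfun T >-> R}))
    (h := fun k => (f n - f (phi k) : {mfun T >-> R})) mac _ _
    mB Bdec B0 (@cvg_geometric2 R) _) => //.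
  + move=> k x kx; have := fg k x kx; rewrite distrC.
    suff -> : (f n - f (phi k)) x - (f n - G) x = g x - f (phi k) x by [].
    by rewrite -[LHS]/(f n x - f (phi k) x - (f n x - g x)); ring.
  + exists n0 => // k /= kn0; apply/ltW/fn0 => //.
    exact: leq_trans (phik k).
Qed.

Theorem theorem7p4 (d : measure_display) (T : measurableType d) (R : realType)
    (mu : nonadditive_measure T R) (p : R)
    (T_nonempty : [set: T] !=set0) (p_gt0 : 0 < p)
    (mu_mac : monotone_autocontinuous_below mu) (mu_C : property_C mu)
    (mu_pgp : pseudometric_generating mu) :
  quasi_complete (fun f : {mfun T >-> R} => weak_norm mu p f) (weakL mu p) /\
  quasi_complete (weak_normq mu_pgp p) (weakLq mu_pgp p).
Proof.
have qc := quasi_complete_weakL p_gt0 mu_mac mu_C mu_pgp.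
split=> // u uL ubd uC.
have normE (f : {mfun T >-> R}) :
    weak_normq mu_pgp p (\pi_(F0q mu_pgp)%qT f) = weak_norm mu p f.
  apply: weak_normqE => //.
  exact: monotone_autocontinuous_below_null_additive.
have piB (f g : {mfun T >-> R}) : (\pi_(F0q mu_pgp) f - \pi_(F0q mu_pgp) g =
    \pi_(F0q mu_pgp) (f - g))%qT.
  rewrite -scaleN1r -[RHS]/(\pi_(F0q mu_pgp) (f + - g))%qT -[- g]scaleN1r.
  by rewrite -F0q_addE -F0q_scaleE.
(* The function case is applied to chosen representatives. These need not be the functions
   witnessing [uL], but null-additivity, through [normE], gives them the same norm. *)
have [| | |g gL ug] := qc (fun n => repr (u n)).
- move=> n; have [f fL fu] := uL n.
  by rewrite /weakL /= -normE reprK -fu normE.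
- exact: ubd.
- move=> e e0; have [n0 un0] := uC e e0; exists n0 => m n mn0 nn0.
  by rewrite -normE -piB !reprK; exact: un0.
- exists (\pi_(F0q mu_pgp)%qT g); first by exists g.
  rewrite /N_cvg; under eq_fun do rewrite -[u _]reprK piB normE.
  exact: ug.
Qed.
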